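(* Let $F:\mathbb{R}^d\to\mathbb{R}^d$ and consider the dynamical system $$\xi_{k+1}=A\xi_k+Bu_k,\qquad y_k=C\xi_k+Du_k,\qquad u_k=F(y_k),\qquad k\ge 0.$$ Suppose $F$ satisfies the pointwise IQC defined by $(\Psi,M)$, and let $\hat A,\hat B,\hat C,\hat D$ be the matrices of the combined system (defined in the context) with state $x_k=\begin{bmatrix}\xi_k\\ \zeta_k\end{bmatrix}$ and fixed point $x^*=\begin{bmatrix}\xi^*\\ \zeta^*\end{bmatrix}$. Consider the linear matrix inequality $$\begin{bmatrix}\hat A^\top P\hat A-\rho^2P & \hat A^\top P\hat B\\ \hat B^\top P\hat A & \hat B^\top P\hat B\end{bmatrix}+\lambda\begin{bmatrix}\hat C&\hat D\end{bmatrix}^\top M\begin{bmatrix}\hat C&\hat D\end{bmatrix}\preceq 0 .$$ If this inequality is feasible for some $P\succ 0$, $\lambda\ge 0$ and $\rho>0$ (where $\rho$ is not necessarily smaller than $1$), then for all $k\ge 0$ $$(x_{k+1}-x^* )^\top(P\otimes \mathbf{I}_d)(x_{k+1}-x^* )\le\rho^2(x_k-x^* )^\top(P\otimes \mathbf{I}_d)(x_k-x^* ).$$ Consequently, for any $\xi_0$ and $\zeta_0=\zeta^*$, for all $k\ge 0$, $$\|\xi_k-\xi^*\|_2^2\le\mathrm{cond}(P)\,\rho^{2k}\,\|\xi_0-\xi^*\|_2^2 .$$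
   Context: $\mathbf{I}_d$ is the $d\times d$ identity, $\otimes$ the Kronecker product, and $\mathrm{cond}(P)$ the ratio of the largest to the smallest eigenvalue of $P$. Here $u_k,y_k\in\mathbb{R}^d$ and $\xi_k\in\mathbb{R}^{nd}$. Auxiliary system $\Psi$: it is specified by matrices $(A_\Psi,B_\Psi^y,B_\Psi^u,C_\Psi,D_\Psi^y,D_\Psi^u)$ and maps sequences $(y,u)$ to a sequence $s$ via $$\zeta_{k+1}=A_\Psi\zeta_k+B_\Psi^yy_k+B_\Psi^uu_k,\qquad s_k=C_\Psi\zeta_k+D_\Psi^yy_k+D_\Psi^uu_k,$$ with the state initialized at the fixed point, $\zeta_0=\zeta^*$. Fixed point: $(\xi^*,\zeta^*,y^*,u^*,s^* )$ satisfies $\xi^*=A\xi^*+Bu^*$, $y^*=C\xi^*+Du^*$, $u^*=F(y^* )$, $\zeta^*=A_\Psi\zeta^*+B_\Psi^yy^*+B_\Psi^uu^*$, $s^*=C_\Psi\zeta^*+D_\Psi^yy^*+D_\Psi^uu^*$; it is assumed to exist. Pointwise IQC: $F$ satisfies the pointwise IQC defined by $(\Psi,M)$, $M$ symmetric, if for every sequence $(y_k)$, with $u_k=F(y_k)$ and $s=\Psi(y,u)$, one has $(s_k-s^* )^\top M(s_k-s^* )\ge 0$ for all $k\ge 0$. Combined system: eliminating $y_k$ gives $x_{k+1}=\hat Ax_k+\hat Bu_k$, $s_k=\hat Cx_k+\hat Du_k$ with $$\hat A=\begin{bmatrix}A&0\\ B_\Psi^yC&A_\Psi\end{bmatrix},\quad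 \hat B=\begin{bmatrix}B\\ B_\Psi^u+B_\Psi^yD\end{bmatrix},\quad \hat C=\begin{bmatrix}D_\Psi^yC&C_\Psi\end{bmatrix},\quad \hat D=D_\Psi^u+D_\Psi^yD.$$ Dimension convention: all of the matrices $A,B,C,D$, those of $\Psi$, and $M$ are of the form $X\otimes\mathbf{I}_d$. In the linear matrix inequality the same symbols $\hat A,\hat B,\hat C,\hat D,M$ denote the reduced factors $X$ (so that the size of $P$ is independent of $d$), while in the dynamics and in the IQC they denote the full matrices $X\otimes \mathbf{I}_d$. *)

(* Defs.v *)
From mathcomp Require Import all_boot all_order all_algebra.
From mathcomp Require Import boolp classical_sets reals.
From mathcomp Require Import mxtens.

Set Implicit Arguments.
Unset Strict Implicit.
Unset Printing Implicit Defensive.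

Import Order.TTheory GRing.Theory Num.Theory.

Local Open Scope ring_scope.
Local Open Scope classical_set_scope.

Section Matrices.
Variable R : realType.

Definition norm2 n (v : 'cV[R]_n) : R := Num.sqrt (\sum_i v i 0 ^+ 2).

Definition qform n (Q : 'M[R]_n) (v : 'cV[R]_n) : R := (v^T *m Q *m v) 0 0.

Definition posdef n (Q : 'M[R]_n) : Prop :=
  Q^T = Q /\ forall v : 'cV[R]_n, v != 0 -> 0 < qform Q v.

Definition negsemidef n (Q : 'M[R]_n) : Prop :=
  Q^T = Q /\ forall v : 'cV[R]_n, qform Q v <= 0.

(* The spectrum is finite, so when it is nonempty (e.g. Q symmetric of positive
   size) the supremum and infimum are the largest and smallest eigenvalues. *)
Definition cond n (Q : 'M[R]_n) : R :=
  sup [set a | eigenvalue Q a] / inf [set a | eigenvalue Q a].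

Definition kronI d p q (X : 'M[R]_(p, q)) : 'M[R]_(p * d, q * d) :=
  X *t (1%:M : 'M[R]_d).

(* R^d identified with R^(1 * d), the space on which kronI d X acts when X has
   a single column; the entries are unchanged. *)
Definition vec1 d (v : 'cV[R]_d) : 'cV[R]_(1 * d) :=
  castmx (esym (mul1n d), erefl 1%N) v.

Definition stack d n m (xi : 'cV[R]_(n * d)) (zeta : 'cV[R]_(m * d)) :
    'cV[R]_((n + m) * d) :=
  castmx (esym (mulnDl n m d), erefl 1%N) (col_mx xi zeta).

End Matrices.

(* Reduced factors: the matrices acting on the signals are their Kronecker
   products with the identity of size d. *)
Record aux_system (R : realType) (m p : nat) := AuxSystem {
  APsi  : 'M[R]_m;
  ByPsi : 'cV[R]_m;
  BuPsi : 'cV[R]_m;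
  CPsi  : 'M[R]_(p, m);
  DyPsi : 'cV[R]_p;
  DuPsi : 'cV[R]_p
}.

Section Systems.
Variables (R : realType) (d n m p : nat).
Implicit Types (A : 'M[R]_n) (B : 'cV[R]_n) (C : 'rV[R]_n) (D : 'M[R]_1).
Implicit Types (Psi : aux_system R m p) (M : 'M[R]_p).
Implicit Types (F : 'cV[R]_d -> 'cV[R]_d).

Definition psi_next Psi (zeta : 'cV[R]_(m * d)) (y u : 'cV[R]_d) :
    'cV[R]_(m * d) :=
  kronI d (APsi Psi) *m zeta + kronI d (ByPsi Psi) *m vec1 y
  + kronI d (BuPsi Psi) *m vec1 u.

Definition psi_read Psi (zeta : 'cV[R]_(m * d)) (y u : 'cV[R]_d) :
    'cV[R]_(p * d) :=
  kronI d (CPsi Psi) *m zeta + kronI d (DyPsi Psi) *m vec1 y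
  + kronI d (DuPsi Psi) *m vec1 u.

Fixpoint psi_state Psi (zeta0 : 'cV[R]_(m * d)) (y u : nat -> 'cV[R]_d)
    (k : nat) : 'cV[R]_(m * d) :=
  if k is k'.+1 then psi_next Psi (psi_state Psi zeta0 y u k') (y k') (u k')
  else zeta0.

Definition psi_out Psi (zeta0 : 'cV[R]_(m * d)) (y u : nat -> 'cV[R]_d)
    (k : nat) : 'cV[R]_(p * d) :=
  psi_read Psi (psi_state Psi zeta0 y u k) (y k) (u k).

Definition trajectory A B C D F (xi : nat -> 'cV[R]_(n * d))
    (y u : nat -> 'cV[R]_d) : Prop :=
  forall k : nat,
    [/\ xi k.+1 = kronI d A *m xi k + kronI d B *m vec1 (u k),
        vec1 (y k) = kronI d C *m xi k + kronI d D *m vec1 (u k)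
      & u k = F (y k)].

Definition fixed_point A B C D Psi F (xis : 'cV[R]_(n * d))
    (zetas : 'cV[R]_(m * d)) (ys us : 'cV[R]_d) (ss : 'cV[R]_(p * d)) : Prop :=
  [/\ xis = kronI d A *m xis + kronI d B *m vec1 us,
      vec1 ys = kronI d C *m xis + kronI d D *m vec1 us,
      us = F ys,
      zetas = psi_next Psi zetas ys us
    & ss = psi_read Psi zetas ys us].

Definition pointwise_IQC F Psi M (zetas : 'cV[R]_(m * d))
    (ss : 'cV[R]_(p * d)) : Prop :=
  forall (y : nat -> 'cV[R]_d) (k : nat),
    0 <= qform (kronI d M) (psi_out Psi zetas y (F \o y) k - ss).

Definition Ahat A C Psi : 'M[R]_(n + m) :=
  block_mx A 0 (ByPsi Psi *m C) (APsi Psi).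

Definition Bhat B D Psi : 'cV[R]_(n + m) :=
  col_mx B (BuPsi Psi + ByPsi Psi *m D).

Definition Chat C Psi : 'M[R]_(p, n + m) :=
  row_mx (DyPsi Psi *m C) (CPsi Psi).

Definition Dhat D Psi : 'cV[R]_p := DuPsi Psi + DyPsi Psi *m D.

End Systems.

Definition lmi_matrix (R : realType) (N p : nat) (Ah : 'M[R]_N) (Bh : 'cV[R]_N)
    (Ch : 'M[R]_(p, N)) (Dh : 'cV[R]_p) (M : 'M[R]_p) (P : 'M[R]_N)
    (lambda rho : R) : 'M[R]_(N + 1) :=
  block_mx (Ah^T *m P *m Ah - rho ^+ 2 *: P) (Ah^T *m P *m Bh)
           (Bh^T *m P *m Ah)                 (Bh^T *m P *m Bh)
  + lambda *: ((row_mx Ch Dh)^T *m M *m row_mx Ch Dh).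

(* Main.v *)
Require Import Defs.
From mathcomp Require Import all_boot all_order all_algebra.
From mathcomp Require Import reals.
From mathcomp Require Import boolp classical_sets mxtens ring lra.

Set Implicit Arguments.
Unset Strict Implicit.
Unset Printing Implicit Defensive.

Import Order.TTheory GRing.Theory Num.Theory.

Local Open Scope ring_scope.

(** With [xs] and [ss] the state and output at the fixed point, the function
    [V x = (x - xs)^T (P (x) I_d) (x - xs)] is a storage function for the
    combined system. Evaluating the linear matrix inequality at the deviation of
    state and input from the fixed point gives
      [V x_{k+1} - rho^2 V x_k + lambda (s_k - ss)^T (M (x) I_d) (s_k - ss) <= 0],
    and the constraint on [F] makes the last term nonnegative, so that [V]
    shrinks by the factor [rho^2] at each step ([qform_lmi],
    [qform_kronI_contract]).

    The inequality has the size of the reduced factors, whereas the signals live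
    in spaces [d] times larger. Reading a vector of [R^(n d)] as an [n x d]
    matrix ([channels]) turns [X (x) I_d] into left multiplication by [X]: the
    dynamics become those of the reduced system on each column, and a quadratic
    form in [Q (x) I_d] is the sum of the forms in [Q] over the columns. The
    inequality is therefore applied column by column and summed. The constraint
    on [F] couples the columns and holds only for their sum.

    To pass from [V] to the norm, [V] is compared with the squared norm through
    the extreme eigenvalues of [P] ([qform_kronI_bounds]). The Rayleigh bounds
    are obtained without diagonalizing [P]: the best lower bound of the Rayleigh
    quotient must be an eigenvalue ([least_eigenvalue_exists]), and the upper
    bound is the lower one for [-P]. Since the auxiliary state starts at its
    fixed point, the initial deviation of the combined state is that of [xi]. *)

(** * Quadratic forms and the squared norm *)

Section QuadraticForms.
Variable R : realType.

Definition sqnorm n (v : 'cV[R]_n) : R := \sum_i v i 0 ^+ 2.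

Lemma norm2_sqr n (v : 'cV[R]_n) : norm2 v ^+ 2 = sqnorm v.
Proof. by rewrite sqr_sqrtr // sumr_ge0 // => i _; apply: sqr_ge0. Qed.

Lemma sqnorm_ge0 n (v : 'cV[R]_n) : 0 <= sqnorm v.
Proof. by apply: sumr_ge0 => i _; apply: sqr_ge0. Qed.

Lemma sqnorm_gt0 n (v : 'cV[R]_n) : v != 0 -> 0 < sqnorm v.
Proof.
move=> v0; rewrite lt_def sqnorm_ge0 andbT; apply: contra v0 => /eqP v0.
apply/eqP/matrixP => i j; rewrite ord1 mxE; apply/eqP; rewrite -sqrf_eq0.
by move/psumr_eq0P: v0 => -> // k _; apply: sqr_ge0.
Qed.

Lemma sqnormE n (v : 'cV[R]_n) : sqnorm v = (v^T *m v) 0 0.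
Proof. by rewrite mxE; apply: eq_bigr => i _; rewrite mxE expr2. Qed.

Lemma qform0 n (Q : 'M[R]_n) : qform Q 0 = 0.
Proof. by rewrite /qform mulmx0 mxE. Qed.

Lemma qformD_mx n (Q1 Q2 : 'M[R]_n) v :
  qform (Q1 + Q2) v = qform Q1 v + qform Q2 v.
Proof. by rewrite /qform mulmxDr mulmxDl mxE. Qed.

Lemma qformZ_mx n a (Q : 'M[R]_n) v : qform (a *: Q) v = a * qform Q v.
Proof. by rewrite /qform -scalemxAr -scalemxAl mxE. Qed.

Lemma qformN_mx n (Q : 'M[R]_n) v : qform (- Q) v = - qform Q v.
Proof. by rewrite /qform mulmxN mulNmx mxE. Qed.

Lemma qform_scalar n a (v : 'cV[R]_n) : qform a%:M v = a * sqnorm v.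
Proof. by rewrite /qform sqnormE mul_mx_scalar -scalemxAl mxE. Qed.

Lemma qform_congr n k (Q : 'M[R]_k) (X : 'M[R]_(k, n)) v :
  qform (X^T *m Q *m X) v = qform Q (X *m v).
Proof. by rewrite /qform trmx_mul !mulmxA. Qed.

(** Only the existence of some bound matters: it makes the infimum of the
    Rayleigh quotient finite, and it bounds the inverse of an invertible
    matrix. *)
Lemma qform_bounded n (Q : 'M[R]_n) :
  exists2 c, 0 < c & forall v, `|qform Q v| <= c * sqnorm v.
Proof.
exists (1 + \sum_j \sum_i `|Q i j|) => [|v].
  rewrite ltr_pwDl // sumr_ge0 // => j _; apply: sumr_ge0 => i _.
  exact: normr_ge0.
have coord i : v i 0 ^+ 2 <= sqnorm v.
  rewrite /sqnorm (bigD1 i) //= lerDl sumr_ge0 // => k _; exact: sqr_ge0.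
rewrite mulrDl mul1r ler_wpDl ?sqnorm_ge0 // /qform mxE mulr_suml.
apply: le_trans (ler_norm_sum _ _ _) _; apply: ler_sum => j _.
rewrite mxE !mulr_suml.
apply: le_trans (ler_norm_sum _ _ _) _; apply: ler_sum => i _.
rewrite mxE mulrAC [_ * Q i j]mulrC normrM ler_wpM2l // ler_norml.
by have := (coord i, coord j, sqr_ge0 (v i 0 - v j 0), sqr_ge0 (v i 0 + v j 0));
   rewrite sqrrB sqrrD => -[[[? ?] ?] ?]; apply/andP; split; lra.
Qed.

(** Evaluating the form at [v - t Q^-1 v] gives
    [0 <= q v - 2 t |v|^2 + t^2 v^T Q^-1 v]; bounding the last term by
    [t^2 c |v|^2] and taking [t = 1 / c] leaves [|v|^2 / c <= q v]. *)
Lemma psd_unit_coercive n (Q : 'M[R]_n) :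
    Q^T = Q -> Q \in unitmx -> (forall v, 0 <= qform Q v) ->
  exists2 e, 0 < e & forall v, e * sqnorm v <= qform Q v.
Proof.
move=> Qsym Qunit Qge0; have [c c0 Hc] := qform_bounded (invmx Q).
exists c^-1 => [|v]; first by rewrite invr_gt0.
have := Qge0 (v - c^-1 *: (invmx Q *m v)).
have -> : qform Q (v - c^-1 *: (invmx Q *m v)) =
    qform Q v - 2 * c^-1 * sqnorm v + c^-1 ^+ 2 * qform (invmx Q) v.
  rewrite /qform [(v - _)^T]linearB /= [(_ *: _)^T]linearZ /= trmx_mul trmx_inv.
  rewrite Qsym mulmxBl -scalemxAl mulmxKV // mulmxBr !mulmxBl.
  rewrite -!scalemxAr -!scalemxAl !mulmxA mulmxK //.
  have entries (x y z w : 'M[R]_1) : (x - y - (z - w)) 0 0 =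
      x 0 0 - y 0 0 - (z 0 0 - w 0 0) by rewrite !mxE.
  have entryZ (a : R) (x : 'M[R]_1) : (a *: x) 0 0 = a * x 0 0 by rewrite mxE.
  by rewrite entries !entryZ -!sqnormE; ring.
have /ler_normlW H := Hc v.
have : c^-1 ^+ 2 * qform (invmx Q) v <= c^-1 * sqnorm v.
  apply: le_trans (ler_wpM2l _ H) _; first exact: sqr_ge0.
  by rewrite expr2 -mulrA mulKf // gt_eqF.
lra.
Qed.

(** * Extreme eigenvalues *)

Lemma eigenvalue_unitmx n (Q : 'M[R]_n) a :
  ~~ eigenvalue Q a -> Q - a%:M \in unitmx.
Proof. by rewrite /eigenvalue negbK kermx_eq0 row_free_unit. Qed.

Lemma eigenvalueN n (Q : 'M[R]_n) a : eigenvalue (- Q) a = eigenvalue Q (- a).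
Proof.
apply/eigenvalueP/eigenvalueP => -[v vQ v0]; exists v => //.
  by rewrite scaleNr -vQ mulmxN opprK.
by rewrite mulmxN vQ scaleNr opprK.
Qed.

Lemma eigenvalue_qform n (Q : 'M[R]_n) a :
  eigenvalue Q a -> exists2 v : 'cV_n, v != 0 & qform Q v = a * sqnorm v.
Proof.
case/eigenvalueP => v vQ v0; exists v^T; first by rewrite trmx_eq0.
by rewrite /qform sqnormE trmxK vQ -scalemxAl mxE.
Qed.

(** The largest [a] with [a |v|^2 <= q v] for all [v] is an eigenvalue:
    otherwise [Q - a] would be positive semidefinite and invertible, hence
    coercive, and [a] could be increased. *)
Lemma least_eigenvalue_exists n (Q : 'M[R]_n) : (0 < n)%N -> Q^T = Q ->
  exists2 a, eigenvalue Q a & forall v, a * sqnorm v <= qform Q v.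
Proof.
move=> n0 Qsym.
pose E := [set a : R | forall v, a * sqnorm v <= qform Q v]%classic.
have E0 : (E !=set0)%classic.
  have [c c0 Hc] := qform_bounded Q; exists (- c) => v.
  by have := Hc v; rewrite ler_norml mulNr => /andP[].
have Eub (v : 'cV[R]_n) : v != 0 -> ubound E (qform Q v / sqnorm v).
  by move=> v0 a Ea; rewrite ler_pdivlMr ?sqnorm_gt0.
have Ebd : has_ubound E.
  pose v : 'cV[R]_n := const_mx 1; exists (qform Q v / sqnorm v); apply: Eub.
  by apply/eqP => /matrixP/(_ (Ordinal n0) 0)/eqP; rewrite !mxE oner_eq0.
(* E is closed: each Rayleigh quotient is an upper bound of E. *)
have Esup v : sup E * sqnorm v <= qform Q v.
  have [->|v0] := eqVneq v 0; last first.
    by rewrite -ler_pdivlMr ?sqnorm_gt0 // ge_sup //; apply: Eub.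
  by rewrite qform0 sqnormE mulmx0 mxE mulr0.
exists (sup E) => //.
have [//|/eigenvalue_unitmx Qunit] := boolP (eigenvalue Q (sup E)).
have shift v : qform (Q - (sup E)%:M) v = qform Q v - sup E * sqnorm v.
  by rewrite qformD_mx qformN_mx qform_scalar.
have [||e e0 He] := psd_unit_coercive _ Qunit.
- by rewrite linearB /= tr_scalar_mx Qsym.
- by move=> v; rewrite shift subr_ge0.
have : sup E + e <= sup E.
  apply: ub_le_sup => // v; have := He v; rewrite shift; lra.
lra.
Qed.

(** The eigenvalue that bounds the Rayleigh quotient from below lies below every
    other eigenvalue, as eigenvalues are values of the quotient; so the infimum
    of the spectrum is attained there. *)
Lemma inf_eigenvalue n (Q : 'M[R]_n) : (0 < n)%N -> Q^T = Q ->
    let a := inf [set b | eigenvalue Q b]%classic in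
  eigenvalue Q a /\ forall v, a * sqnorm v <= qform Q v.
Proof.
move=> n0 Qsym a; have [b Qb Hb] := least_eigenvalue_exists n0 Qsym.
have lb : lbound [set c | eigenvalue Q c]%classic b.
  move=> c /eigenvalue_qform[v v0 qv].
  by rewrite -(ler_pM2r (sqnorm_gt0 v0)) -qv.
suff -> : a = b by [].
apply/eqP; rewrite eq_le lb_le_inf ?andbT; [|by exists b|exact: lb].
by apply: ge_inf => //; exists b.
Qed.

(** The least eigenvalue of [-Q] is the opposite of the greatest one of [Q]. *)
Lemma qform_le_sup_eigenvalue n (Q : 'M[R]_n) v : (0 < n)%N -> Q^T = Q ->
  qform Q v <= sup [set b | eigenvalue Q b]%classic * sqnorm v.
Proof.
move=> n0 Qsym; have [|b Qb Hb] := least_eigenvalue_exists (Q := - Q) n0.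
  by rewrite linearN /= Qsym.
rewrite eigenvalueN in Qb.
have le_b w : qform Q w <= - b * sqnorm w.
  by have := Hb w; rewrite qformN_mx; lra.
apply: le_trans (le_b v) _; apply: ler_wpM2r; first exact: sqnorm_ge0.
apply: ub_le_sup => //; exists (- b) => c /eigenvalue_qform[w w0 qw].
by rewrite -(ler_pM2r (sqnorm_gt0 w0)) -qw.
Qed.

End QuadraticForms.

(** * Separating the channels of a Kronecker product *)

Section Channels.
Variables (R : realType) (d : nat).

(** The inverse of the row-major vectorization: a vector of [R^(n d)] becomes
    an [n x d] matrix, on which [X (x) I_d] acts as left multiplication by [X].
    Each of the [d] columns is then a signal of the reduced system. *)
Definition channels n (v : 'cV[R]_(n * d)) : 'M[R]_(n, d) :=
  \matrix_(i, j) v (mxtens_index (i, j)) 0.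

Lemma channelsD n (v w : 'cV[R]_(n * d)) :
  channels (v + w) = channels v + channels w.
Proof. by apply/matrixP => i j; rewrite !mxE. Qed.

Lemma channelsB n (v w : 'cV[R]_(n * d)) :
  channels (v - w) = channels v - channels w.
Proof. by apply/matrixP => i j; rewrite !mxE. Qed.

Lemma sum_mxtens n (f : 'I_(n * d) -> R) :
  \sum_k f k = \sum_i \sum_j f (mxtens_index (i, j)).
Proof.
rewrite pair_big /= (reindex (@mxtens_index n d)) /=.
  by apply: eq_bigr => -[].
by exists (@mxtens_unindex n d) => k _;
   rewrite (mxtens_indexK, mxtens_unindexK).
Qed.

Lemma channels_kronI n q (X : 'M[R]_(q, n)) v :
  channels (kronI d X *m v) = X *m channels v.
Proof.
apply/matrixP => i j; rewrite !mxE sum_mxtens; apply: eq_bigr => k _.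
rewrite (bigD1 j) //= tensmxE !mxE eqxx mulr1 big1 ?addr0 // => l lj.
by rewrite tensmxE mxE eq_sym (negPf lj) mulr0 mul0r.
Qed.

Lemma channels_vec1 (v : 'cV[R]_d) : channels (vec1 v) = v^T.
Proof.
apply/matrixP => i j; rewrite !mxE castmxE /= cast_ord_id ord1.
by congr (v _ _); apply: val_inj.
Qed.

Lemma channels_stack n m (v : 'cV[R]_(n * d)) (w : 'cV[R]_(m * d)) :
  channels (stack v w) = col_mx (channels v) (channels w).
Proof.
apply/matrixP => i j; rewrite mxE castmxE /= cast_ord_id esymK.
case: (split_ordP i) => k ->.
  rewrite col_mxEu [RHS]mxE -[RHS](col_mxEu v w).
  by congr (col_mx v w _ _); apply: val_inj.
rewrite col_mxEd [RHS]mxE -[RHS](col_mxEd v w).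
by congr (col_mx v w _ _); apply: val_inj; rewrite /= mulnDl addnA.
Qed.

(** Entrywise, the form of [Q (x) I_d] couples only entries of the same
    column. *)
Lemma qform_kronI n (Q : 'M[R]_n) v :
  qform (kronI d Q) v = \sum_j qform Q (col j (channels v)).
Proof.
rewrite /qform -mulmxA mxE sum_mxtens exchange_big /=; apply: eq_bigr => j _.
rewrite -mulmxA mxE; apply: eq_bigr => i _; rewrite !mxE; congr (_ * _).
have := channels_kronI Q v => /matrixP/(_ i j); rewrite !mxE => ->.
by apply: eq_bigr => k _; rewrite !mxE.
Qed.

Lemma sqnorm_channels n (v : 'cV[R]_(n * d)) :
  sqnorm v = \sum_j sqnorm (col j (channels v)).
Proof.
rewrite /sqnorm sum_mxtens exchange_big; apply: eq_bigr => j _.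
by apply: eq_bigr => i _; rewrite !mxE.
Qed.

Lemma stackB n m (v v' : 'cV[R]_(n * d)) (w w' : 'cV[R]_(m * d)) :
  stack v w - stack v' w' = stack (v - v') (w - w').
Proof.
by apply/matrixP => i j; rewrite !(mxE, castmxE) /=; case: splitP => k _;
   rewrite !mxE.
Qed.

Lemma sqnorm_stack n m (v : 'cV[R]_(n * d)) (w : 'cV[R]_(m * d)) :
  sqnorm (stack v w) = sqnorm v + sqnorm w.
Proof.
rewrite !sqnorm_channels channels_stack -big_split /=; apply: eq_bigr => j _.
rewrite /sqnorm big_split_ord /=.
by congr (_ + _); apply: eq_bigr => i _;
   rewrite mxE (col_mxEu, col_mxEd) [in RHS]mxE.
Qed.

End Channels.

(** * Dissipation *)

Section Dissipation.
Variable R : realType.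

Lemma row_mx_congr n1 n2 k (Q : 'M[R]_k) (X : 'M[R]_(k, n1))
    (Y : 'M[R]_(k, n2)) :
  (row_mx X Y)^T *m Q *m row_mx X Y =
  block_mx (X^T *m Q *m X) (X^T *m Q *m Y) (Y^T *m Q *m X) (Y^T *m Q *m Y).
Proof. by rewrite tr_row_mx mul_col_mx mul_col_row. Qed.

(** The inequality is a dissipation inequality: the blocks in [P] measure the
    change of storage from [e] to its successor [Ah e + Bh w], discounted by
    [rho^2], and the term in [M] is the supply at the output. *)
Lemma qform_lmi N p (Ah : 'M[R]_N) (Bh : 'cV[R]_N) (Ch : 'M[R]_(p, N))
    (Dh : 'cV[R]_p) (M : 'M[R]_p) (P : 'M[R]_N) lambda rho
    (e : 'cV[R]_N) (w : 'cV[R]_1) :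
  qform (lmi_matrix Ah Bh Ch Dh M P lambda rho) (col_mx e w) =
  qform P (Ah *m e + Bh *m w) - rho ^+ 2 * qform P e
  + lambda * qform M (Ch *m e + Dh *m w).
Proof.
(* Each summand is a congruence by a block row: [Ah Bh], [I 0] or [Ch Dh]. *)
have -> : lmi_matrix Ah Bh Ch Dh M P lambda rho =
    (row_mx Ah Bh)^T *m P *m row_mx Ah Bh
    - rho ^+ 2 *: ((row_mx 1%:M 0)^T *m P *m row_mx 1%:M 0)
    + lambda *: ((row_mx Ch Dh)^T *m M *m row_mx Ch Dh).
  rewrite /lmi_matrix; congr (_ + _).
  rewrite !row_mx_congr trmx1 trmx0 !mul0mx !mulmx0 mul1mx mulmx1.
  by rewrite scale_block_mx !scaler0 opp_block_mx add_block_mx !oppr0 !addr0.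
rewrite !qformD_mx qformN_mx !qformZ_mx !qform_congr !mul_row_col.
by rewrite mul1mx mul0mx addr0.
Qed.

End Dissipation.

Section CombinedSystem.
Variables (R : realType) (d n m p : nat).
Variables (A : 'M[R]_n) (B : 'cV[R]_n) (C : 'rV[R]_n) (D : 'M[R]_1).
Variable Psi : aux_system R m p.

(** This equation eliminates [y] from the next two lemmas. All three concern a
    single step, without reference to [F], so that they apply both to a
    trajectory and to the fixed point. *)
Lemma channels_output (xi : 'cV[R]_(n * d)) (y u : 'cV[R]_d) :
    vec1 y = kronI d C *m xi + kronI d D *m vec1 u ->
  y^T = C *m channels xi + D *m u^T.
Proof.
by rewrite -(channels_vec1 y) => ->; rewrite channelsD !channels_kronI
   channels_vec1.
Qed.

Lemma channels_next (xi : 'cV[R]_(n * d)) zeta (y u : 'cV[R]_d) :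
    vec1 y = kronI d C *m xi + kronI d D *m vec1 u ->
  channels (stack (kronI d A *m xi + kronI d B *m vec1 u)
                  (psi_next Psi zeta y u)) =
  Ahat A C Psi *m channels (stack xi zeta) + Bhat B D Psi *m u^T.
Proof.
move=> /channels_output yE; rewrite !channels_stack /psi_next !channelsD.
rewrite !channels_kronI !channels_vec1 yE mul_block_col mul_col_mx.
rewrite add_col_mx mul0mx addr0 mulmxDr mulmxDl !mulmxA; congr col_mx.
rewrite addrA [in LHS](addrC (_ *m channels zeta)) -!addrA.
by rewrite [in RHS](addrC (_ *m u^T)).
Qed.

Lemma channels_read (xi : 'cV[R]_(n * d)) zeta (y u : 'cV[R]_d) :
    vec1 y = kronI d C *m xi + kronI d D *m vec1 u ->
  channels (psi_read Psi zeta y u) =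
  Chat C Psi *m channels (stack xi zeta) + Dhat D Psi *m u^T.
Proof.
move=> /channels_output yE; rewrite channels_stack /psi_read !channelsD.
rewrite !channels_kronI !channels_vec1 yE mul_row_col mulmxDr mulmxDl !mulmxA.
rewrite addrA [in LHS](addrC (_ *m channels zeta)) -!addrA.
by rewrite [in RHS](addrC (_ *m u^T)).
Qed.

End CombinedSystem.

(** The constraint speaks of every input sequence [y], with [u] given by [F];
    a trajectory of the feedback loop is one such choice. *)
Lemma pointwise_IQC_trajectory (R : realType) (d n m p : nat)
    (A : 'M[R]_n) (B : 'cV[R]_n) (C : 'rV[R]_n) (D : 'M[R]_1)
    (F : 'cV[R]_d -> 'cV[R]_d) (Psi : aux_system R m p) (M : 'M[R]_p)
    zetas ss xi y u k :
    pointwise_IQC F Psi M zetas ss -> trajectory A B C D F xi y u ->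
  0 <= qform (kronI d M)
             (psi_read Psi (psi_state Psi zetas y u k) (y k) (u k) - ss).
Proof.
move=> HIQC Htraj; have -> : u = F \o y by apply/funext => i; case: (Htraj i).
exact: HIQC.
Qed.

(** * Convergence *)

Lemma col_affine (R : realType) n q d (X : 'M[R]_(q, n)) (Y : 'cV[R]_q)
    (V : 'M[R]_(n, d)) (W : 'rV[R]_d) j :
  col j (X *m V + Y *m W) = X *m col j V + Y *m col j W.
Proof. by rewrite !colE mulmxDl !mulmxA. Qed.

(** Deviations from the fixed point obey the reduced dynamics columnwise, since
    the fixed point satisfies the same affine relations as the trajectory; the
    inequality is then summed over the columns, where the supply is
    nonnegative. *)
Lemma qform_kronI_contract (R : realType) d n m p
    (A : 'M[R]_n) (B : 'cV[R]_n) (C : 'rV[R]_n) (D : 'M[R]_1)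
    (F : 'cV[R]_d -> 'cV[R]_d) (Psi : aux_system R m p) (M : 'M[R]_p)
    xis zetas ys us ss (P : 'M[R]_(n + m)) lambda rho xi y u :
    fixed_point A B C D Psi F xis zetas ys us ss ->
    pointwise_IQC F Psi M zetas ss -> 0 <= lambda ->
    negsemidef (lmi_matrix (Ahat A C Psi) (Bhat B D Psi) (Chat C Psi)
                           (Dhat D Psi) M P lambda rho) ->
    trajectory A B C D F xi y u ->
    let x k := stack (xi k) (psi_state Psi zetas y u k) in
    let xs := stack xis zetas in
  forall k, qform (kronI d P) (x k.+1 - xs)
            <= rho ^+ 2 * qform (kronI d P) (x k - xs).
Proof.
move=> [xisE ysE _ zetasE ssE] HIQC lambda0 [_ HLMI] Htraj x xs k.
pose X := channels (x k - xs); pose U := (u k - us)^T.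
have [xiE yE _] := Htraj k.
have nextE : channels (x k.+1 - xs) = Ahat A C Psi *m X + Bhat B D Psi *m U.
  have xsE : channels xs = Ahat A C Psi *m channels xs + Bhat B D Psi *m us^T.
    by rewrite -(channels_next A B Psi zetas ysE) -xisE -zetasE.
  rewrite channelsB /x xiE (channels_next A B Psi _ yE) xsE /X /U channelsB.
  by rewrite [(u k - us)^T]linearB /= !mulmxBr opprD addrACA.
have readE : channels (psi_read Psi (psi_state Psi zetas y u k) (y k) (u k) - ss)
    = Chat C Psi *m X + Dhat D Psi *m U.
  rewrite channelsB (channels_read Psi _ yE) ssE (channels_read Psi _ ysE).
  by rewrite /X /U channelsB [(u k - us)^T]linearB /= !mulmxBr opprD addrACA.
have supply := pointwise_IQC_trajectory k HIQC Htraj.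
have LMI j := HLMI (col_mx (col j X) (col j U)).
rewrite qform_kronI readE in supply; rewrite !qform_kronI nextE -/X.
have : \sum_j (qform P (col j (Ahat A C Psi *m X + Bhat B D Psi *m U))
      - rho ^+ 2 * qform P (col j X)
      + lambda * qform M (col j (Chat C Psi *m X + Dhat D Psi *m U))) <= 0.
  by apply: sumr_le0 => j _; rewrite !col_affine -qform_lmi.
rewrite big_split sumrB -!mulr_sumr /=.
have := mulr_ge0 lambda0 supply; lra.
Qed.

Lemma qform_kronI_bounds (R : realType) d n (P : 'M[R]_n) (v : 'cV[R]_(n * d)) :
    (0 < n)%N -> P^T = P ->
  inf [set a | eigenvalue P a]%classic * sqnorm v <= qform (kronI d P) v
  <= sup [set a | eigenvalue P a]%classic * sqnorm v.
Proof.
move=> n0 Psym; rewrite qform_kronI sqnorm_channels !mulr_sumr.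
have [_ Hinf] := inf_eigenvalue n0 Psym.
apply/andP; split; apply: ler_sum => j _; first exact: Hinf.
exact: qform_le_sup_eigenvalue.
Qed.

Theorem theorem1 (R : realType) (d n m p : nat)
  (A : 'M[R]_n) (B : 'cV[R]_n) (C : 'rV[R]_n) (D : 'M[R]_1)
  (F : 'cV[R]_d -> 'cV[R]_d)
  (Psi : aux_system R m p) (M : 'M[R]_p) (M_sym : M^T = M)
  (xis : 'cV[R]_(n * d)) (zetas : 'cV[R]_(m * d)) (ys us : 'cV[R]_d)
  (ss : 'cV[R]_(p * d))
  (Hfix : fixed_point A B C D Psi F xis zetas ys us ss)
  (HIQC : pointwise_IQC F Psi M zetas ss)
  (P : 'M[R]_(n + m)) (lambda rho : R)
  (HP : posdef P) (Hlambda : 0 <= lambda) (Hrho : 0 < rho)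
  (HLMI : negsemidef (lmi_matrix (Ahat A C Psi) (Bhat B D Psi) (Chat C Psi)
                                 (Dhat D Psi) M P lambda rho))
  (xi : nat -> 'cV[R]_(n * d)) (y u : nat -> 'cV[R]_d)
  (Htraj : trajectory A B C D F xi y u) :
  let zeta := psi_state Psi zetas y u in
  let x k := stack (xi k) (zeta k) in
  let xs := stack xis zetas in
  (forall k : nat,
     qform (kronI d P) (x k.+1 - xs) <= rho ^+ 2 * qform (kronI d P) (x k - xs))
  /\
  (forall k : nat,
     norm2 (xi k - xis) ^+ 2
     <= cond P * rho ^+ (2 * k) * norm2 (xi 0%N - xis) ^+ 2).
Proof.
move=> zeta x xs.
have contract := qform_kronI_contract Hfix HIQC Hlambda HLMI Htraj.
split=> // k; have [Psym Ppos] := HP; rewrite !norm2_sqr.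
(* If n + m = 0 then P has no eigenvalue; but n = 0 makes both norms vanish. *)
have [n0|n_gt0] := posnP n.
  have sq0 (v : 'cV[R]_(n * d)) : sqnorm v = 0.
    rewrite sqnorm_channels big1 // => j _; rewrite /sqnorm big1 // => i _.
    by have := ltn_ord i; rewrite [X in (_ < X)%N]n0.
  by rewrite !sq0 mulr0.
have N_gt0 : (0 < n + m)%N by rewrite addn_gt0 n_gt0.
have [/eigenvalue_qform[v v0 qv] _] := inf_eigenvalue N_gt0 Psym.
rewrite /cond; set lmin := inf _ in qv *; set lmax := sup _.
have lmin_gt0 : 0 < lmin by rewrite -(pmulr_lgt0 _ (sqnorm_gt0 v0)) -qv Ppos.
have decay : qform (kronI d P) (x k - xs)
    <= rho ^+ (2 * k) * qform (kronI d P) (x 0%N - xs).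
  elim: k => [|k IH]; first by rewrite muln0 expr0 mul1r.
  apply: le_trans (contract k) _.
  by rewrite mulnS exprD -mulrA ler_wpM2l // sqr_ge0.
have /andP[low _] := qform_kronI_bounds (x k - xs) N_gt0 Psym.
have /andP[_ high] := qform_kronI_bounds (x 0%N - xs) N_gt0 Psym.
(* The auxiliary state starts at its fixed point, so initially the combined
   deviation is that of xi. *)
have sq_x0 : sqnorm (x 0%N - xs) = sqnorm (xi 0%N - xis).
  by rewrite stackB sqnorm_stack subrr [sqnorm 0]big1 ?addr0 // => i _;
     rewrite mxE expr0n.
have sq_xk : sqnorm (xi k - xis) <= sqnorm (x k - xs).
  by rewrite stackB sqnorm_stack lerDl sqnorm_ge0.
rewrite sq_x0 in high.
have -> : lmax / lmin * rho ^+ (2 * k) * sqnorm (xi 0%N - xis) =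
    rho ^+ (2 * k) * (lmax * sqnorm (xi 0%N - xis)) / lmin by ring.
rewrite ler_pdivlMr // mulrC.
apply: le_trans (ler_wpM2l (ltW lmin_gt0) sq_xk) _; apply: le_trans low _.
apply: le_trans decay _; apply: ler_wpM2l high.
by rewrite exprn_ge0 // ltW.
Qed.
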